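(* Let $\mathbb{X}$ be a metrizable topological space with its Borel $\sigma$-algebra, and let $\mathbb{Y},\tilde{\mathbb{Y}}$ be measurable spaces whose $\sigma$-algebras are countably generated and contain all singletons. Let $h\colon\mathbb{X}\to\mathbb{Y}$ be measurable and let $\mu$ be a $\sigma$-finite Radon measure on $\mathbb{X}$ such that $h_\star\mu$ is $\sigma$-finite. Let $f\colon\mathbb{Y}\to\tilde{\mathbb{Y}}$ be an isomorphism of measurable spaces (a bijection, measurable with measurable inverse). Then, for $h_\star\mu$-almost every $y\in\mathbb{Y}$, $$\mu^h(\,\cdot\mid y)=\mu^{f\circ h}(\,\cdot\mid f(y)).$$
   Context: Disintegration: given a measurable map $h\colon\mathbb{X}\to\mathbb{Y}$ and a measure $\mu$ on $\mathbb{X}$, a disintegration of $\mu$ with respect to $h$ is a map $(A,y)\mapsto\mu^h(A\mid y)\in[0,\infty]$ such that $\mu^h(\,\cdot\mid y)$ is a measure on $\mathbb{X}$ for all $y\in\mathbb{Y}$, $y\mapsto\mu^h(A\mid y)$ is measurable for every measurable $A\subset\mathbb{X}$, (i) $\mu^h(\mathbb{X}\setminus h^{-1}(\{y\})\mid y)=0$, and (ii) $\mu(A)=\int_{\mathbb{Y}}\mu^h(A\mid y)\,h_\star\mu(dy)$ for every measurable $A$, where $h_\star\mu$ is the pushforward. Under the assumptions here it exists and is unique up to $h_\star\mu$-null sets of $y$. *)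

(* Defs.v *)
From HB Require Import structures.
From mathcomp Require Import all_boot all_order all_algebra.
From mathcomp Require Import all_classical all_reals all_analysis.

Set Implicit Arguments.
Unset Strict Implicit.
Unset Printing Implicit Defensive.

Import Order.TTheory GRing.Theory Num.Theory.
Import numFieldNormedType.Exports.

Local Open Scope classical_set_scope.
Local Open Scope ring_scope.
Local Open Scope ereal_scope.

Definition is_metric (R : realType) (T : Type) (dist : T -> T -> R) : Prop :=
  [/\ forall x y, (0 <= dist x y)%R,
      forall x y, dist x y = 0%R <-> x = y,
      forall x y, dist x y = dist y x &
      forall x y z, (dist x z <= dist x y + dist y z)%R].

Definition metrizable (R : realType) (T : topologicalType) : Prop :=
  exists dist : T -> T -> R,
    is_metric dist /\
    forall U : set T, open U <->
      (forall x, U x ->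
         exists2 e : R, (0 < e)%R & [set y | (dist x y < e)%R] `<=` U).

Notation borel X := (g_sigma_algebraType (@open X)).

(* On a metrizable space, finiteness on compact sets together with inner
   regularity is equivalent to local finiteness together with inner
   regularity, so the two usual definitions of a Radon measure agree. *)
Definition radon (R : realType) (X : ptopologicalType)
    (mu : {measure set (borel X) -> \bar R}) : Prop :=
  (forall K : set X, compact K -> mu K < +oo) /\
  (forall A : set (borel X), measurable A ->
     mu A = ereal_sup [set mu K | K in
              [set K : set X | compact K /\ K `<=` (A : set X)]]).

Definition countably_generated d (T : measurableType d) : Prop :=
  exists2 G : set (set T), countable G & @measurable d T = <<s G >>.

Definition singletons_measurable d (T : measurableType d) : Prop :=
  forall y : T, measurable [set y].

Definition measurable_iso d1 d2 (T1 : measurableType d1)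
    (T2 : measurableType d2) (f : T1 -> T2) : Prop :=
  measurable_fun [set: T1] f /\
  exists g : T2 -> T1,
    [/\ cancel f g, cancel g f & measurable_fun [set: T2] g].

(* [nu y A] is the value mu^h(A | y); that [nu y] is a measure for every y and
   that y |-> nu y A is measurable for every measurable A is part of the kernel
   structure. *)
Definition disintegration (R : realType) d1 d2 (X : measurableType d1)
    (Y : measurableType d2) (mu : {measure set X -> \bar R}) (h : X -> Y)
    (nu : R.-ker Y ~> X) : Prop :=
  (forall y, nu y (~` (h @^-1` [set y])) = 0) /\
  (forall A, measurable A -> mu A = \int[pushforward mu h]_y nu y A).

(* Main.v *)
(* Two disintegrations of mu with respect to h agree almost everywhere on each
   fixed set A of finite measure, because both integrate over every C to
   mu (A `&` h @^-1` C).  To let A vary, one needs countably many test sets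
   although the Borel sigma-algebra of X need not be countably generated: a
   sigma-finite Radon measure is concentrated on a sigma-compact set S, compact
   subsets of a metrizable space have a countable base, hence the traces on S of
   the Borel sets come from a countable pi-system.  Finally, f being injective,
   y |-> mu^(f o h)( . | f y) is a disintegration with respect to h. *)

Require Import Defs.
From HB Require Import structures.
From mathcomp Require Import all_boot all_order all_algebra.
From mathcomp Require Import all_classical all_reals all_analysis.
From mathcomp Require Import measurable_realfun.

Set Implicit Arguments.
Unset Strict Implicit.
Unset Printing Implicit Defensive.

Import Order.TTheory GRing.Theory Num.Theory.
Import numFieldNormedType.Exports.

Local Open Scope classical_set_scope.
Local Open Scope ring_scope.
Local Open Scope ereal_scope.

(** * Kernels composed with a measurable map *)

Section kernel_precomp.
Context d d' d'' (X : measurableType d) (Y : measurableType d')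
  (Y' : measurableType d'') (R : realType).
Variables (k : R.-ker Y' ~> X) (f : Y -> Y') (mf : measurable_fun [set: Y] f).

(* The measurability proof is an argument so that the kernel structure can be
   inferred from the term. *)
Definition kernel_precomp of measurable_fun [set: Y] f :
  Y -> {measure set X -> \bar R} := fun y => k (f y).

Let measurable_kernel_precomp U : measurable U ->
  measurable_fun [set: Y] (kernel_precomp mf ^~ U : Y -> \bar R).
Proof.
by move=> mU; apply: (measurableT_comp (measurable_kernel k U mU)).
Qed.

HB.instance Definition _ := isKernel.Build _ _ _ _ _ (kernel_precomp mf)
  measurable_kernel_precomp.

End kernel_precomp.

(** * Almost everywhere uniqueness of disintegrations *)

Section uniqueness.
Context d d' (X : measurableType d) (Y : measurableType d') (R : realType).
Variables (mu : {measure set X -> \bar R}) (h : X -> Y).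
Hypothesis mh : measurable_fun [set: X] h.
Hypothesis Ysing : singletons_measurable Y.

(* The measure structure of [pushforward mu h] depends on [mh], which
   unification cannot find, hence the explicit instance. *)
Let hmu : {measure set Y -> \bar R} :=
  measure_function_pushforward__canonical__measure_function_Measure mu mh.

Let measurable_preimage_h (C : set Y) :
  measurable C -> measurable (h @^-1` C).
Proof. by move=> mC; rewrite -[X in measurable X]setTI; exact: mh. Qed.

(** Since [nu y] is carried by the fibre over [y], cutting [A] down to the preimage of [C] leaves
    [nu y A] unchanged for [y] in [C] and gives 0 for all other [y]. *)
Lemma disintegration_restrict (nu : R.-ker Y ~> X) A C :
  disintegration mu h nu -> measurable A -> measurable C ->
  mu (A `&` h @^-1` C) = \int[pushforward mu h]_(y in C) nu y A.
Proof.
move=> [nu0 muE] mA mC.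
have mhC := measurable_preimage_h mC.
rewrite muE; last exact: measurableI.
rewrite [RHS]integral_mkcond; apply: eq_integral => y _; rewrite patchE.
have mhy : measurable (~` (h @^-1` [set y])).
  by apply: measurableC; apply: measurable_preimage_h.
case: ifPn => [/set_mem Cy|/negP yC].
  rewrite -[in RHS](setUIDK A (h @^-1` C)) measureU0//.
  - exact: measurableI.
  - exact: measurableD.
  - apply: (subset_measure0 _ mhy _ (nu0 y)); first exact: measurableD.
    by move=> x [_ /= hx] /= hxy; apply: hx; rewrite hxy.
apply: (subset_measure0 _ mhy _ (nu0 y)); first exact: measurableI.
by move=> x [_ /= hx] /= hxy; apply: yC; rewrite -hxy; exact: mem_set.
Qed.

(** By [disintegration_restrict] both functions of [y] have the same integral over every measurable
    set, and finiteness of [mu A] makes the first one integrable. *)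
Lemma disintegration_ae_eq (nu1 nu2 : R.-ker Y ~> X) A :
  disintegration mu h nu1 -> disintegration mu h nu2 ->
  measurable A -> mu A < +oo ->
  {ae pushforward mu h, forall y, nu1 y A = nu2 y A}.
Proof.
move=> dis1 dis2 mA Afin.
have mnu (nu : R.-ker Y ~> X) : measurable_fun setT (nu ^~ A).
  exact: measurable_kernel.
have : ae_eq hmu setT (nu1 ^~ A) (nu2 ^~ A).
  apply: integral_ae_eq => //.
    apply/integrableP; split; first exact: mnu.
    under eq_integral do rewrite gee0_abs//.
    by rewrite -(disintegration_restrict dis1)//= preimage_setT setIT.
  move=> E _ mE.
  by rewrite -!disintegration_restrict.
by apply: filterS => y /(_ I).
Qed.

Lemma disintegration_ae_fin_num (nu : R.-ker Y ~> X) A :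
  disintegration mu h nu -> measurable A -> mu A < +oo ->
  {ae pushforward mu h, forall y, nu y A \is a fin_num}.
Proof.
move=> [_ muE] mA Afin.
have : hmu.-integrable setT (nu ^~ A).
  apply/integrableP; split; first exact: measurable_kernel.
  by under eq_integral do rewrite gee0_abs//; rewrite -muE.
by move/(integrable_ae measurableT); apply: filterS => y /(_ I).
Qed.

Lemma disintegration_ae_null (nu : R.-ker Y ~> X) A :
  disintegration mu h nu -> measurable A -> mu A = 0 ->
  {ae pushforward mu h, forall y, nu y A = 0}.
Proof.
move=> [_ muE] mA A0.
have mnu : measurable_fun [set: Y] (nu ^~ A) by exact: measurable_kernel.
have /(ae_eq_integral_abs hmu measurableT mnu) : \int[hmu]_y `|nu y A| = 0.
  by under eq_integral do rewrite gee0_abs//; rewrite -A0 muE.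
by apply: filterS => y /(_ I).
Qed.

(** The hypothesis on traces stands in for countable generation: only countably many exceptional
    null sets have to be united. *)
Lemma disintegration_unique (nu1 nu2 : R.-ker Y ~> X) (B : nat -> set X)
    (S : set X) :
  sigma_finite [set: X] mu ->
  (forall i, measurable (B i)) -> measurable S -> mu (~` S) = 0 ->
  (forall A, measurable A ->
    exists2 A', <<s range B >> A' & A `&` S = A' `&` S) ->
  disintegration mu h nu1 -> disintegration mu h nu2 ->
  {ae pushforward mu h, forall y A, measurable A -> nu1 y A = nu2 y A}.
Proof.
move=> /sigma_finiteP[F [FT ndF Ffin]] mB mS S0 trS dis1 dis2.
have mF n : measurable (F n) by case: (Ffin n).
have Foo n : mu (F n) < +oo by case: (Ffin n).
(* Test sets: finite intersections of the [B i], cut by [F n] so that [mu] is finite on them. As [F]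
   increases they form a pi-system, and their index type is countable. *)
pose g (p : nat * seq nat) := F p.1 `&` \big[setI/setT]_(i <- p.2) B i.
have mg p : measurable (g p).
  by apply: measurableI => //; exact: bigsetI_measurable.
have ae_g : {ae hmu, forall y p, nu1 y (g p) = nu2 y (g p)}.
  (* The indices are enumerated by their codes; a number coding nothing imposes the trivial
     condition. *)
  have : {ae hmu, forall y n, if unpickle n is Some p then
      nu1 y (g p) = nu2 y (g p) else True}.
    apply: ae_foralln => n; case: unpickle => [p|]; last exact: aeW.
    apply: disintegration_ae_eq => //.
    by rewrite (le_lt_trans _ (Foo p.1))// le_measure ?inE//; exact: subIsetl.
  by apply: filterS => y gy p; have := gy (pickle p); rewrite pickleK.
(* Uniqueness of measures on a pi-system asks for finiteness of [nu1 y] along an exhausting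
   sequence. *)
have ae_F : {ae hmu, forall y n, nu1 y (F n) \is a fin_num}.
  by apply: ae_foralln => n; exact: disintegration_ae_fin_num.
have mSC : measurable (~` S) by exact: measurableC.
have ae_S : {ae hmu, forall y, nu1 y (~` S) = 0 /\ nu2 y (~` S) = 0}.
  by apply: filterI; exact: disintegration_ae_null.
suff : {ae hmu, forall y A, measurable A -> nu1 y A = nu2 y A} by [].
move: ae_g ae_F ae_S; apply: filterS3 => y gy Fy [S1 S2] A mA.
have [A' BA' AS] := trS A mA.
have restrS (m : {measure set X -> \bar R}) E :
    m (~` S) = 0 -> measurable E -> m E = m (E `&` S).
  move=> m0 mE; rewrite -[in LHS](setUIDK E S) measureU0//.
  - exact: measurableI.
  - exact: measurableD.
  - by apply: (subset_measure0 _ mSC _ m0) => [|x []//]; exact: measurableD.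
have mA' : measurable A'.
  move: A' BA' {AS}; apply: smallest_sub; first exact: sigma_algebra_measurable.
  by move=> _ [i _ <-].
(* The complement of [S] being null, [A] may be exchanged for [A'], which lies in the sigma-algebra
   of the test sets. *)
rewrite (restrS (nu1 y))// (restrS (nu2 y))// AS -!restrS//.
apply: (g_sigma_algebra_measure_unique (range g) _ F) => //.
- by move=> _ [p _ <-].
- by move=> n; exists (n, [::]) => //; rewrite /g big_nil setIT.
- move=> _ _ [[n s] _ <-] [[m t] _ <-]; exists (minn n m, s ++ t) => //.
  rewrite /g/= big_cat/= setIACA; congr (_ `&` _).
  have [nm|mn] := leqP n m.
    by rewrite (setIidl _)//; apply/subsetPset/ndF.
  by rewrite (setIidr _)//; apply/subsetPset/ndF/ltnW.
- by move=> _ [p _ <-]; exact: gy.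
- by move=> k; rewrite -ge0_fin_numE//; exact: Fy.
move: A' BA' {AS mA'}; apply: smallest_sub; first exact: smallest_sigma_algebra.
(* [F] exhausts the space, so each [B i] is a countable union of test sets. *)
move=> _ [i _ <-]; have -> : B i = \bigcup_n g (n, [:: i]).
  rewrite -[LHS]setTI FT setI_bigcupl; apply: eq_bigcupr => n _.
  by rewrite /g big_seq1.
apply: sigma_algebra_bigcup => n.
by apply: sub_sigma_algebra; exists (n, [:: i]).
Qed.

End uniqueness.

(** * Transport of a disintegration along an injective map *)

Lemma disintegration_precomp d d' d'' (X : measurableType d)
    (Y : measurableType d') (Y' : measurableType d'') (R : realType)
    (mu : {measure set X -> \bar R}) (h : X -> Y) (f : Y -> Y')
    (k : R.-ker Y' ~> X) (mf : measurable_fun [set: Y] f) :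
  measurable_fun [set: X] h -> injective f ->
  disintegration mu (f \o h) k -> disintegration mu h (kernel_precomp k mf).
Proof.
move=> mh injf [k0 muE]; split=> [y|A mA].
  (* Injectivity of [f] identifies the fibre of [f \o h] over [f y] with the fibre of [h] over
     [y]. *)
  rewrite -(k0 (f y)); congr (k (f y) (~` _)).
  by apply/seteqP; split => x /=; [move->|exact: injf].
rewrite muE//.
have mk : measurable_fun [set: Y'] (k ^~ A) by exact: measurable_kernel.
(* Both sides become the integral of [k (f (h x)) A] against [mu]. *)
rewrite ge0_integral_pushforward//; last exact: measurableT_comp.
rewrite ge0_integral_pushforward//.
exact: (measurableT_comp mk mf).
Qed.

(** * Countable bases in metrizable spaces and traces of sigma-algebras *)

Lemma metrizable_ball (R : realType) (T : topologicalType) :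
  metrizable R T -> exists dist : T -> T -> R,
    [/\ is_metric dist, forall x e, open [set y | (dist x y < e)%R] &
      forall U x, open U -> U x ->
        exists2 e : R, (0 < e)%R & [set y | (dist x y < e)%R] `<=` U].
Proof.
move=> [dist [metd openE]]; exists dist.
split=> // [x e|U x /openE]; last exact.
have [_ _ _ dist_tri] := metd; apply/openE => y /= xye.
exists (e - dist x y)%R; first by rewrite subr_gt0.
move=> z /= yz; rewrite (le_lt_trans (dist_tri _ y _))//.
by rewrite -ltrBrDl.
Qed.

Lemma metrizable_hausdorff (R : realType) (T : topologicalType) :
  metrizable R T -> hausdorff_space T.
Proof.
move=> /metrizable_ball[dist [[dist_ge0 dist_eq0 distC dist_tri] ball_open _]].
rewrite open_hausdorff => x y xy.
have d0 : (0 < dist x y)%R.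
  rewrite lt_neqAle dist_ge0 andbT eq_sym; apply: contra xy => /eqP.
  by move=> /dist_eq0 ->.
exists ([set z | (dist x z < dist x y / 2)%R],
        [set z | (dist y z < dist x y / 2)%R]); split => //=.
- rewrite inE /=; have -> : dist x x = 0%R by exact/dist_eq0.
  by rewrite divr_gt0.
- rewrite inE /=; have -> : dist y y = 0%R by exact/dist_eq0.
  by rewrite divr_gt0.
apply/eqP; rewrite -subset0 => z [/= xz yz].
have := dist_tri x z y; rewrite (distC z) leNgt => /negP; apply.
by rewrite [ltRHS]splitr ltrD.
Qed.

(** Each [K n] is covered by finitely many balls of radius 1/(m+1); collecting these over all n and
    m gives the countable base. *)
Lemma metrizable_sigma_compact_base (R : realType) (T : ptopologicalType)
    (K : nat -> set T) :
  metrizable R T -> (forall n, compact (K n)) ->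
  exists2 B : nat -> set T, forall i, open (B i) &
    forall U x, open U -> (\bigcup_n K n) x -> U x ->
      exists2 i, B i x & B i `<=` U.
Proof.
move=> /metrizable_ball[dist [[_ dist_eq0 distC dist_tri] ball_open open_ball]].
move=> Kc.
have /choice[c cP] (p : nat * nat) : exists s : seq T, forall x, K p.1 x ->
    exists2 y, y \in s & (dist y x < p.2.+1%:R^-1)%R.
  have := Kc p.1; rewrite compact_cover => /(_ T setT
    (fun y => [set x | (dist y x < p.2.+1%:R^-1)%R])) [||D _ DK].
  - by move=> y _; exact: ball_open.
  - move=> x _; exists x => //=; have -> : dist x x = 0%R by exact/dist_eq0.
    by rewrite invr_gt0.
  - by exists (finmap.enum_fset D) => x /DK [y /= yD xy]; exists y.
(* The triple (n, m, j) codes the ball of radius 1/(m+1) about the j-th centre for [K n]. Beyond the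
   list the centre is [point], which is harmless since that ball is open too. *)
pose ballB (p : nat * nat * nat) : set T :=
  [set x | (dist (nth point (c p.1) p.2) x < p.1.2.+1%:R^-1)%R].
exists (fun i => if unpickle i is Some p then ballB p else set0).
  by move=> i; case: unpickle => [p|]; [exact: ball_open|exact: open0].
move=> U x oU [n _ Kx] /(open_ball _ _ oU)[e e0 eU].
(* Half of [e], because [x] and [z] are compared through the centre [y]. *)
have [m me] : exists m, (m.+1%:R^-1 < e / 2)%R.
  have e20 : (0 < e / 2)%R by rewrite divr_gt0.
  near \oo => m; exists m; near: m; exact: near_infty_natSinv_lt (PosNum e20).
have [y ys yx] := cP (n, m) x Kx.
exists (pickle (n, m, index y (c (n, m)))).
  by rewrite pickleK /ballB /= nth_index.
rewrite pickleK /ballB /= nth_index//.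
move=> z /= yz; apply: eU => /=.
rewrite (le_lt_trans (dist_tri _ y _))// [ltRHS]splitr ltrD//.
  by rewrite distC (lt_trans yx).
exact: lt_trans yz me.
Unshelve. all: by end_near. Qed.

(** The sets whose trace on [S] has such a representative form a sigma-algebra, so it suffices to
    treat the generators [O]. *)
Lemma sigma_algebra_trace_range (T : Type) (O : set (set T))
    (B : nat -> set T) (S : set T) :
  (forall U x, O U -> S x -> U x -> exists2 i, B i x & B i `<=` U) ->
  forall A, <<s O >> A -> exists2 A', <<s range B >> A' & A `&` S = A' `&` S.
Proof.
move=> Bbase; apply: smallest_sub; first split.
- exists set0 => //; exact: sigma_algebra0.
- move=> A [A' BA' AS]; exists (setT `\` A'); first exact: sigma_algebraCD.
  apply/seteqP; split=> x [[_ nA] Sx]; split => //; split => // Ax; apply: nA.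
    by have [] : (A `&` S) x by rewrite AS.
  by have [] : (A' `&` S) x by rewrite -AS.
- move=> A Atr; have /choice[A' A'P] n : exists A'n, <<s range B >> A'n /\
      A n `&` S = A'n `&` S by have [A'n] := Atr n; exists A'n.
  exists (\bigcup_n A' n).
    by apply: sigma_algebra_bigcup => n; have [] := A'P n.
  by rewrite !setI_bigcupl; apply: eq_bigcupr => n _; have [] := A'P n.
(* By the base property, the countably many [B i] inside [U] fill out [U] on [S]. *)
- move=> U OU; exists (\bigcup_(i in [set i | B i `<=` U]) B i).
    rewrite bigcup_mkcond; apply: sigma_algebra_bigcup => i; case: ifPn => _.
      by apply: sub_sigma_algebra; exists i.
    exact: sigma_algebra0.
  apply/seteqP; split=> x [Ux Sx]; split => //.
    by have [i Bx BU] := Bbase U x OU Sx Ux; exists i.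
  by have [i BU Bx] := Ux; exact: BU.
Qed.

(** * Sigma-compact carriers of Radon measures *)

Lemma radon_sigma_compact (R : realType) (X : ptopologicalType)
    (mu : {measure set (borel X) -> \bar R}) :
  metrizable R X -> sigma_finite [set: borel X] mu -> radon mu ->
  exists2 K : nat -> set X, forall n, compact (K n) &
    measurable (\bigcup_n K n : set (borel X)) /\
    mu (~` (\bigcup_n K n)) = 0.
Proof.
move=> metX [F FT Ffin] [_ muE].
have cmeas (K : set X) : compact K -> measurable (K : set (borel X)).
  move=> cK; rewrite -(setCK K); apply: measurableC.
  apply: sub_sigma_algebra; rewrite openC.
  exact: compact_closed (metrizable_hausdorff metX) cK.
(* For p = (n, m), inner regularity exhausts the finite value [mu (F n)] up to 1/(m+1) by a compact
   subset. *)
have /choice[K KP] (p : nat * nat) : exists K : set X, [/\ compact K,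
    K `<=` F p.1 & mu (F p.1) - p.2.+1%:R^-1%:E < mu K].
  have [mF Foo] := Ffin p.1.
  have Ffn : mu (F p.1) \is a fin_num by rewrite ge0_fin_numE.
  have e0 : (0 < p.2.+1%:R^-1 :> R)%R by rewrite invr_gt0.
  move: (Ffn); rewrite muE// => /(ub_ereal_sup_adherent e0).
  by rewrite -muE// => -[_ [L [cL LF] <-] FL]; exists L.
pose K' i := if unpickle i is Some p then K p else set0.
have K'c i : compact (K' i).
  by rewrite /K'; case: unpickle => [p|]; [have [] := KP p|exact: compact0].
have mK' : measurable (\bigcup_n K' n : set (borel X)).
  by apply: bigcupT_measurable => i; exact: cmeas.
exists K' => //; split => //.
have null n : mu (F n `\` \bigcup_n K' n) = 0.
  have [mF Foo] := Ffin n.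
  apply/eqP; rewrite eq_le measure_ge0 andbT.
  (* The remainder is bounded by [mu (F n) - mu (K (n, m))], which falls below any [e] for suitable
     m. *)
  apply/lee_addgt0Pr => e e0; rewrite add0e.
  have [m me] : exists m, (m.+1%:R^-1 < e)%R.
    near \oo => m; exists m; near: m; exact: near_infty_natSinv_lt (PosNum e0).
  have [cK KF muK] := KP (n, m).
  apply: (@le_trans _ _ (mu (F n `\` K (n, m)))).
    apply: le_measure; rewrite ?inE; first exact: measurableD.
    - by apply: measurableD => //; exact: cmeas.
    - apply: setDS => x Kx; exists (pickle (n, m)) => //.
      by rewrite /K' pickleK.
  rewrite measureD//; last exact: cmeas.
  rewrite setIidr//.
  rewrite leeBlDl; last first.
    rewrite ge0_fin_numE// (le_lt_trans _ Foo)// le_measure ?inE//.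
    exact: cmeas.
  rewrite -leeBlDr//; apply/ltW; apply: le_lt_trans muK.
  by rewrite leeB// lee_fin ltW.
apply: measure_negligible; first exact: measurableC.
rewrite -(setTD (\bigcup_n K' n)) FT setDE setI_bigcupl.
apply: negligible_bigcup => n; apply/negligibleP; last exact: null.
by apply: measurableD => //; case: (Ffin n).
Unshelve. all: by end_near. Qed.

Theorem proposition2p11 (R : realType) (X : ptopologicalType)
    (d d' : measure_display) (Y : measurableType d) (Y' : measurableType d')
    (hX : metrizable R X)
    (hYgen : countably_generated Y) (hYsing : singletons_measurable Y)
    (hY'gen : countably_generated Y') (hY'sing : singletons_measurable Y')
    (h : borel X -> Y) (hmeas : measurable_fun [set: borel X] h)
    (mu : {measure set (borel X) -> \bar R})
    (mu_sigma_finite : sigma_finite [set: borel X] mu)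
    (mu_radon : radon mu)
    (hmu_sigma_finite : sigma_finite [set: Y] (pushforward mu h))
    (f : Y -> Y') (f_iso : measurable_iso f)
    (mu_h : R.-ker Y ~> borel X) (mu_h_dis : disintegration mu h mu_h)
    (mu_fh : R.-ker Y' ~> borel X)
    (mu_fh_dis : disintegration mu (f \o h) mu_fh) :
  {ae pushforward mu h, forall y : Y,
    forall A : set (borel X), measurable A -> mu_h y A = mu_fh (f y) A}.
Proof.
have [mf [g [fK _ _]]] := f_iso.
have [K Kc [mK K0]] := radon_sigma_compact hX mu_sigma_finite mu_radon.
have [B oB Bbase] := metrizable_sigma_compact_base hX Kc.
apply: (@disintegration_unique _ _ (borel X) _ _ _ _ hmeas hYsing mu_h
  (kernel_precomp mu_fh mf) B (\bigcup_n K n)) => //.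
- by move=> i; exact: sub_sigma_algebra.
(* The Borel sets are by definition generated by the open sets, for which [Bbase] is the base
   property required. *)
- by apply: sigma_algebra_trace_range => U x; exact: Bbase.
- exact: disintegration_precomp (can_inj fK) mu_fh_dis.
Qed.
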